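(* Let $X$ be a Lowen fuzzy topological space. If $X$ is exponentiable in $\mathbf{LFTS}$, then $\tau_X$ is a continuous lattice: $$\mu=\bigvee\{\rho\in\tau_X:\rho\ll\mu\}\qquad(\mu\in\tau_X).$$
   Context: Let $\mathbb{I}=[0,1]$ with its usual order. A (stratified) Lowen fuzzy topology on a set $X$ is a subset $\tau_X\subseteq\mathbb{I}^X$ containing all constant maps and closed under arbitrary pointwise joins and finite pointwise meets; $(X,\tau_X)$ is a Lowen fuzzy topological space. A map $f:X\to Y$ is continuous if $v\circ f\in\tau_X$ for all $v\in\tau_Y$. $\mathbf{LFTS}$ is the category of Lowen fuzzy topological spaces and continuous maps; its binary product $Z\times X$ carries the least Lowen topology containing $a\circ\mathrm{pr}_Z$ ($a\in\tau_Z$) and $b\circ\mathrm{pr}_X$ ($b\in\tau_X$). $X$ is exponentiable in $\mathbf{LFTS}$ if the functor $-\times X:\mathbf{LFTS}\to\mathbf{LFTS}$ has a right adjoint. $\tau_X$ is regarded as a complete lattice in the pointwise order, and $\ll$ is its way-below relation: $\rho\ll\mu$ iff for every (nonempty) directed $D\subseteq\tau_X$ with $\mu\le\bigvee D$ there is $\nu\in D$ with $\rho\le\nu$. *)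

(* Defs.v *)
From mathcomp Require Import all_boot all_order all_algebra.
From mathcomp Require Import all_classical all_reals.

Set Implicit Arguments.
Unset Strict Implicit.
Unset Printing Implicit Defensive.

Import Order.TTheory GRing.Theory Num.Theory.

Local Open Scope classical_set_scope.
Local Open Scope ring_scope.

Record category := Category {
  obj :> Type;
  hom : obj -> obj -> Type;
  idm : forall A, hom A A;
  comp : forall A B C, hom B C -> hom A B -> hom A C;
  comp_idl : forall A B (f : hom A B), comp (idm B) f = f;
  comp_idr : forall A B (f : hom A B), comp f (idm A) = f;
  comp_assoc : forall A B C D (h : hom C D) (g : hom B C) (f : hom A B),
    comp h (comp g f) = comp (comp h g) f
}.

Record functor (C D : category) := Functor {
  fobj :> C -> D;
  fmap : forall A B : C, hom A B -> hom (fobj A) (fobj B);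
  fmap_id : forall A : C, fmap (idm A) = idm (fobj A);
  fmap_comp : forall (A B E : C) (g : hom B E) (f : hom A B),
    fmap (comp g f) = comp (fmap g) (fmap f)
}.

(* An adjunction F -| G, given by hom-set bijections natural in A and B. *)
Record adjunction (C D : category) (F : functor C D) (G : functor D C) :=
  Adjunction {
  transpose : forall (A : C) (B : D), hom (F A) B -> hom A (G B);
  transpose_bij : forall A B, bijective (@transpose A B);
  transpose_natl : forall (A A' : C) (B : D) (h : hom A' A) (f : hom (F A) B),
    transpose (comp f (fmap F h)) = comp (transpose f) h;
  transpose_natr : forall (A : C) (B B' : D) (k : hom B B') (f : hom (F A) B),
    transpose (comp k f) = comp (fmap G k) (transpose f)
}.

Definition has_right_adjoint (C D : category) (F : functor C D) : Prop :=
  exists G : functor D C, inhabited (adjunction F G).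

Section FuzzySets.
Variable R : realType.

(* The elements of I^X, represented as the [0,1]-valued functions X -> R. *)
Definition fuzzy_set (X : Type) : set (X -> R) :=
  [set f | forall x, 0 <= f x <= 1].

(* On families of fuzzy sets this is the join of I^X; in particular the
   empty family is sent to the bottom element, because sup set0 = 0. *)
Definition pjoin (X : Type) (A : set (X -> R)) : X -> R :=
  fun x => sup [set f x | f in A].

Definition pmeet (X : Type) (f g : X -> R) : X -> R :=
  fun x => Num.min (f x) (g x).

(* The empty meet is the constant map 1, so binary meets suffice. *)
Record is_lowen (X : Type) (tau : set (X -> R)) : Prop := IsLowen {
  lowen_fuzzy : tau `<=` fuzzy_set (X := X);
  lowen_cst : forall c : R, 0 <= c <= 1 -> tau (fun=> c);
  lowen_join : forall A : set (X -> R), A `<=` tau -> tau (pjoin A);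
  lowen_meet : forall f g, tau f -> tau g -> tau (pmeet f g)
}.

Record lfts := LFTS {
  carrier :> Type;
  opens : set (carrier -> R);
  opensP : is_lowen opens
}.

Record cmap (X Y : lfts) := CMap {
  cmap_fun :> X -> Y;
  cmapP : forall v, opens (l := Y) v -> opens (l := X) (v \o cmap_fun)
}.

Lemma cmap_eq (X Y : lfts) (f g : cmap X Y) :
  (f : X -> Y) = (g : X -> Y) -> f = g.
Proof.
by case: f g => f fP [g gP] /= fg; subst g; congr CMap; exact: Prop_irrelevance.
Qed.

Lemma id_cmap_subproof (X : lfts) v :
  opens (l := X) v -> opens (l := X) (v \o (fun x : X => x)).
Proof. by []. Qed.

Definition id_cmap (X : lfts) : cmap X X := CMap (@id_cmap_subproof X).

Lemma comp_cmap_subproof (X Y Z : lfts) (g : cmap Y Z) (f : cmap X Y) v :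
  opens (l := Z) v -> opens (l := X) (v \o (g \o f)).
Proof. by move=> /(cmapP g) /(cmapP f). Qed.

Definition comp_cmap (X Y Z : lfts) (g : cmap Y Z) (f : cmap X Y) : cmap X Z :=
  CMap (comp_cmap_subproof g f).

Definition LFTS_cat : category.
Proof.
by refine (@Category lfts cmap id_cmap comp_cmap _ _ _) => *; exact: cmap_eq.
Defined.

Lemma pjoin_fuzzy (X : Type) (A : set (X -> R)) :
  A `<=` fuzzy_set (X := X) -> fuzzy_set (pjoin A).
Proof.
move=> A01 x; rewrite /pjoin.
have [->|] := eqVneq A set0; first by rewrite image_set0 sup0 lexx ler01.
  case/set0P => f Af.
have ub1 : ubound [set g x | g in A] 1.
  by move=> _ [g Ag <-]; have /andP[] := A01 _ Ag x.
have ne : [set g x | g in A] !=set0 by exists (f x), f.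
apply/andP; split; last exact: ge_sup.
have /andP[f0 _] := A01 _ Af x.
by apply: (le_trans f0); apply: ub_le_sup; [exists 1 | exists f].
Qed.

Lemma fuzzy_set_lowen (X : Type) : is_lowen (fuzzy_set (X := X)).
Proof.
split=> //.
- by move=> c c01 x.
- exact: pjoin_fuzzy.
move=> f g f01 g01 x; rewrite /pmeet.
by case: (leP (f x) (g x)) => _; [exact: f01 | exact: g01].
Qed.

Lemma smallest_lowen (X : Type) (G : set (X -> R)) :
  G `<=` fuzzy_set (X := X) -> is_lowen (smallest (@is_lowen X) G).
Proof.
move=> G01; split.
- by apply: smallest_sub => //; exact: fuzzy_set_lowen.
- by move=> c c01 M [ML _]; exact: lowen_cst ML _ c01.
- by move=> A AG M MP; apply: (lowen_join MP.1) => f /AG; exact.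
- by move=> f g Gf Gg M MP; apply: (lowen_meet MP.1); [exact: Gf | exact: Gg].
Qed.

Definition prod_subbase (Z X : lfts) : set ((Z * X) -> R) :=
  [set a \o fst | a in opens (l := Z)] `|` [set b \o snd | b in opens (l := X)].

Lemma prod_lowen_subproof (Z X : lfts) :
  is_lowen (smallest (@is_lowen (Z * X)) (@prod_subbase Z X)).
Proof.
apply: smallest_lowen => _ [[a aZ <-]|[b bX <-]] z /=.
  exact: (lowen_fuzzy (opensP Z) aZ).
exact: (lowen_fuzzy (opensP X) bX).
Qed.

Definition prod_lfts (Z X : lfts) : lfts := LFTS (@prod_lowen_subproof Z X).

Lemma prod_map_subproof (X Z Z' : lfts) (f : cmap Z Z') v :
  opens (l := prod_lfts Z' X) v ->
  opens (l := prod_lfts Z X) (v \o (fun p : Z * X => (f p.1, p.2))).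
Proof.
set h := fun p : Z * X => (f p.1, p.2).
pose M := [set w : Z' * X -> R |
  fuzzy_set w /\ opens (l := prod_lfts Z X) (w \o h)].
have PL := opensP (prod_lfts Z X).
have ML : is_lowen M.
  split.
  - by move=> w [].
  - by move=> c c01; split; [move=> ? | exact: lowen_cst PL _ c01].
  - move=> A AM; split; first by apply: pjoin_fuzzy => w /AM[].
    have -> : pjoin A \o h = pjoin [set w \o h | w in A].
      by apply/funext => x; rewrite /pjoin /= image_comp.
    by apply: (lowen_join PL) => _ [w /AM[_ Mw] <-].
  - move=> w w' [w01 Mw] [w'01 Mw']; split.
      exact: (lowen_meet (fuzzy_set_lowen _)).
    exact: lowen_meet PL _ _ Mw Mw'.
move=> vP; suff [] : M v by [].
apply: (smallest_sub ML _ vP) => _ [[a aZ <-]|[b bX <-]]; split.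
- by move=> x; exact: (lowen_fuzzy (opensP Z') aZ).
- by apply: sub_gen_smallest; left; exists (a \o f) => //; exact: cmapP.
- by move=> x; exact: (lowen_fuzzy (opensP X) bX).
- by apply: sub_gen_smallest; right; exists b.
Qed.

Definition prod_map (X Z Z' : lfts) (f : cmap Z Z') :
    cmap (prod_lfts Z X) (prod_lfts Z' X) :=
  CMap (@prod_map_subproof X Z Z' f).

(* The functor - x X. *)
Definition prod_functor (X : lfts) : functor LFTS_cat LFTS_cat.
Proof.
refine (@Functor LFTS_cat LFTS_cat (fun Z => prod_lfts Z X)
          (fun Z Z' f => prod_map X f) _ _).
- by move=> Z; apply: cmap_eq; apply/funext => -[].
- by move=> Z Z' Z'' g f; apply: cmap_eq.
Defined.

Definition exponentiable (X : lfts) : Prop :=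
  has_right_adjoint (prod_functor X).

Definition fle (X : Type) (f g : X -> R) : Prop := forall x, f x <= g x.

Definition directed (X : Type) (D : set (X -> R)) : Prop :=
  D !=set0 /\
  forall f g, D f -> D g -> exists h, [/\ D h, fle f h & fle g h].

(* Joins in the complete lattice tau are pointwise, by lowen_join. *)
Definition way_below (X : Type) (tau : set (X -> R)) (rho mu : X -> R) : Prop :=
  forall D : set (X -> R), D `<=` tau -> directed D -> fle mu (pjoin D) ->
    exists nu, D nu /\ fle rho nu.

Definition continuous_lattice (X : Type) (tau : set (X -> R)) : Prop :=
  forall mu, tau mu ->
    mu = pjoin [set rho | tau rho /\ way_below tau rho mu].

End FuzzySets.

(* Main.v *)
Require Import Defs.
From mathcomp Require Import all_boot all_order all_algebra.
From mathcomp Require Import all_classical all_reals.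

(** The unit interval, with the Lowen topology generated by its inclusion into
    the reals, is a Sierpinski object: continuous maps into it are the same
    thing as open fuzzy sets.  If - x X has a right adjoint G, then G applied
    to this object is a space E of open fuzzy sets of X.  It has two
    properties.

    On the one hand the evaluation map on E x X is open in the product
    ([exponential_evaluation]), so it is a join of rectangles
    min (a p) (b x) with a open in E and b open in X ([prod_open_rect]).

    On the other hand every open a of E is Scott continuous on open fuzzy
    sets ([name_scott]).  To see this, let D be a directed family whose join
    lies above mu.  Equip D together with a limit point with the topology of
    the fuzzy sets that are lower semicontinuous at the limit along D.  Sending
    d to min (d, mu) and the limit to mu is a map whose graph is open
    ([net_graph_open]), so it transposes to a continuous map into E; composing
    it with a gives an open fuzzy set, and lower semicontinuity of the latter
    is the wanted statement.

    Now let 0 <= s < mu x.  Some rectangle under the evaluation map is above s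
    at (mu, x), that is s < a mu and s < b x.  Then rho = min (s, b) is way
    below mu: if D is directed with join above mu, then by Scott continuity
    there is d in D such that s < a p for p = min (d, mu), hence
    rho y <= min (a p) (b y) <= p y <= d y for all y.  As rho x = s, the fuzzy
    sets way below mu have join mu. *)

Set Implicit Arguments.
Unset Strict Implicit.
Unset Printing Implicit Defensive.

Import Order.TTheory GRing.Theory Num.Theory.

Local Open Scope classical_set_scope.
Local Open Scope ring_scope.

(** * Joins of fuzzy sets *)

Section LowenTopologies.
Variable R : realType.

Lemma opens_fuzzy (Z : lfts R) (a : Z -> R) : opens (l := Z) a -> fuzzy_set a.
Proof. exact: (lowen_fuzzy (opensP Z)). Qed.

Lemma fuzzy_set_cst (T : Type) (c : R) :
  0 <= c <= 1 -> fuzzy_set (fun=> c : R) (X := T).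
Proof. by move=> c01 x. Qed.

Lemma pjoin_ub (T : Type) (A : set (T -> R)) f x :
  A `<=` fuzzy_set (X := T) -> A f -> f x <= pjoin A x.
Proof.
move=> A01 Af; apply: ub_le_sup; last by exists f.
by exists 1 => _ [g Ag <-]; have /andP[] := A01 _ Ag x.
Qed.

(** The second alternative accounts for the empty family, whose join is 0. *)
Lemma pjoin_gt (T : Type) (A : set (T -> R)) x (t : R) :
  t < pjoin A x -> (exists2 f, A f & t < f x) \/ t < 0.
Proof.
rewrite /pjoin; have [->|/set0P A0] := eqVneq A set0.
  by rewrite image_set0 sup0; right.
move=> /sup_gt[|_ [f Af <-] tf]; last by left; exists f.
by case: A0 => f Af; exists (f x), f.
Qed.

Lemma pjoin_le (T : Type) (A : set (T -> R)) x (c : R) :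
  0 <= c -> (forall f, A f -> f x <= c) -> pjoin A x <= c.
Proof.
move=> c0 Ac; rewrite leNgt; apply/negP => cA.
case: (pjoin_gt cA) => [[f Af cf]|c0'].
  by move: cf; rewrite ltNge Ac.
by move: c0'; rewrite ltNge c0.
Qed.

(** The final Lowen topology along f; minimality of a generated topology
    against it reduces continuity of f to the generators. *)
Lemma preimage_lowen (Y : lfts R) (T : Type) (f : Y -> T) :
  is_lowen [set w : T -> R | fuzzy_set w /\ opens (l := Y) (w \o f)].
Proof.
have YL := opensP Y; split.
- by move=> w [].
- by move=> c c01; split; [exact: fuzzy_set_cst | exact: (lowen_cst YL c01)].
- move=> A AM; split; first by apply: pjoin_fuzzy => w /AM[].
  have -> : pjoin A \o f = pjoin [set w \o f | w in A].
    by apply/funext => x; rewrite /pjoin /= image_comp.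
  by apply: (lowen_join YL) => _ [w /AM[_ Mw] <-].
- move=> w w' [w01 Mw] [w'01 Mw']; split.
    exact: (lowen_meet (fuzzy_set_lowen _ _)).
  exact: (lowen_meet YL Mw Mw').
Qed.

(** * The Sierpinski object *)

Definition unit_interval : Type := {c : R | 0 <= c <= 1}.

Definition level (c : unit_interval) : R := proj1_sig c.

Lemma level_fuzzy : [set level] `<=` fuzzy_set (X := unit_interval).
Proof. by move=> _ -> [c c01]. Qed.

Definition sierpinski : lfts R := LFTS (smallest_lowen level_fuzzy).

Lemma level_open : opens (l := sierpinski) level.
Proof. exact: sub_gen_smallest. Qed.

Section Classifier.
Variables (Y : lfts R) (v : Y -> R) (vY : opens (l := Y) v).

Definition classifier_fun (y : Y) : sierpinski :=
  exist _ (v y) (opens_fuzzy vY y).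

Lemma classifier_continuous w :
  opens (l := sierpinski) w -> opens (l := Y) (w \o classifier_fun).
Proof.
move=> wS.
have [] := smallest_sub (preimage_lowen classifier_fun) _ wS => //.
by move=> _ ->; split; [exact: level_fuzzy|].
Qed.

Definition classifier : cmap Y sierpinski := CMap classifier_continuous.

End Classifier.

(** * Products *)

Lemma fst_open (Z X : lfts R) (a : Z -> R) :
  opens (l := Z) a -> opens (l := prod_lfts Z X) (a \o fst).
Proof. by move=> aZ; apply: sub_gen_smallest; left; exists a. Qed.

Lemma snd_open (Z X : lfts R) (b : X -> R) :
  opens (l := X) b -> opens (l := prod_lfts Z X) (b \o snd).
Proof. by move=> bX; apply: sub_gen_smallest; right; exists b. Qed.

(** Rectangles are closed under binary meets and contain the constants, and
    meets distribute over joins in the unit interval, so the joins of rectangles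
    already form a Lowen topology. *)
Lemma prod_open_rect (Z X : lfts R) (w : Z * X -> R) :
  opens (l := prod_lfts Z X) w -> forall z x t, t < w (z, x) ->
  exists a b, [/\ opens (l := Z) a, opens (l := X) b, t < a z, t < b x &
    forall z' x', Num.min (a z') (b x') <= w (z', x')].
Proof.
have ZL := opensP Z; have XL := opensP X.
pose M := [set w : Z * X -> R | fuzzy_set w /\ forall z x t, t < w (z, x) ->
  exists a b, [/\ opens (l := Z) a, opens (l := X) b, t < a z, t < b x &
    forall z' x', Num.min (a z') (b x') <= w (z', x')]].
suff ML : is_lowen M.
  move=> wP; suff [] : M w by [].
  apply: (smallest_sub ML _ wP) => _ [[a aZ <-]|[b bX <-]]; split.
  - by move=> p; exact: opens_fuzzy aZ p.1.
  - move=> z x t /= ta; exists a, (fun=> 1); split => //.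
    + by apply: (lowen_cst XL); rewrite ler01 lexx.
    + by apply: lt_le_trans ta _; case/andP: (opens_fuzzy aZ z).
    + by move=> z' x'; rewrite ge_min lexx.
  - by move=> p; exact: opens_fuzzy bX p.2.
  - move=> z x t /= tb; exists (fun=> 1), b; split => //.
    + by apply: (lowen_cst ZL); rewrite ler01 lexx.
    + by apply: lt_le_trans tb _; case/andP: (opens_fuzzy bX x).
    + by move=> z' x'; rewrite ge_min lexx orbT.
split.
- by move=> ? [].
- move=> c c01; split=> [|z x t tc]; first exact: fuzzy_set_cst.
  exists (fun=> c), (fun=> c); split=> //; [exact: (lowen_cst ZL c01)| |].
    exact: (lowen_cst XL c01).
  by move=> *; rewrite minxx.
- move=> A AM.
  have A01 : A `<=` fuzzy_set (X := Z * X) by move=> f /AM[].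
  split=> [|z x t]; first exact: pjoin_fuzzy.
  move=> tA; case: (pjoin_gt tA) => [[f Af tf]|t0].
    have [a [b [aZ bX ta tb abf]]] := (AM _ Af).2 _ _ _ tf.
    exists a, b; split=> // z' x'; apply: le_trans (abf z' x') _.
    exact: pjoin_ub.
  exists (fun=> 0), (fun=> 0); split=> //.
  + by apply: (lowen_cst ZL); rewrite ler01 lexx.
  + by apply: (lowen_cst XL); rewrite ler01 lexx.
  + by move=> z' x'; rewrite minxx; case/andP: (pjoin_fuzzy A01 (z', x')).
- move=> f g [f01 fM] [g01 gM]; split=> [|z x t].
    exact: (lowen_meet (fuzzy_set_lowen _ _)).
  rewrite /pmeet lt_min => /andP[/fM[a [b [aZ bX ta tb abf]]]].
  move=> /gM[a' [b' [a'Z b'X ta' tb' abg]]].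
  exists (pmeet a a'), (pmeet b b'); rewrite /pmeet; split.
  + exact: (lowen_meet ZL aZ a'Z).
  + exact: (lowen_meet XL bX b'X).
  + by rewrite lt_min ta.
  + by rewrite lt_min tb.
  + by move=> z' x'; rewrite minACA le_min2.
Qed.

(** * Points *)

Definition point_lfts : lfts R := LFTS (fuzzy_set_lowen R unit).

Lemma point_continuous (Z : lfts R) (z : Z) v :
  opens (l := Z) v -> opens (l := point_lfts) (v \o (fun=> z)).
Proof. by move=> vZ y; exact: opens_fuzzy vZ z. Qed.

Definition point (Z : lfts R) (z : Z) : cmap point_lfts Z :=
  CMap (@point_continuous Z z).

(** * Convergence along a directed family *)

Section Net.
Variables (X : Type) (D : set (X -> R)).

(** The limit point is [None].  Taking all functions as further points, rather
    than the members of D only, avoids a subtype: convergence to the limit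
    is tested along D alone. *)
Definition net_opens : set (option (X -> R) -> R) :=
  [set g | fuzzy_set g /\ forall t, t < g None ->
     exists2 d, D d & forall d', D d' -> fle d d' -> t < g (Some d')].

Hypothesis dirD : directed D.

(** Stability under binary meets is where common upper bounds in D enter. *)
Lemma net_lowen : is_lowen net_opens.
Proof.
case: dirD => -[d0 Dd0] Ddir; split.
- by move=> g [].
- by move=> c c01; split=> [|t tc]; [exact: fuzzy_set_cst | exists d0].
- move=> A AM.
  have A01 : A `<=` fuzzy_set (X := option (X -> R)) by move=> g /AM[].
  split=> [|t]; first exact: pjoin_fuzzy.
  move=> tA; case: (pjoin_gt tA) => [[g Ag tg]|t0].
    have [d Dd dg] := (AM _ Ag).2 _ tg; exists d => // d' Dd' dd'.
    by apply: lt_le_trans (dg _ Dd' dd') _; exact: pjoin_ub.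
  exists d0 => // d' _ _; apply: lt_le_trans t0 _.
  by case/andP: (pjoin_fuzzy A01 (Some d')).
- move=> f g [f01 fM] [g01 gM]; split=> [|t].
    exact: (lowen_meet (fuzzy_set_lowen _ _)).
  rewrite /pmeet lt_min => /andP[/fM[d Dd df] /gM[e De eg]].
  have [h [Dh dh eh]] := Ddir _ _ Dd De.
  exists h => // d' Dd' hd'; rewrite lt_min df ?eg // => x.
    exact: le_trans (eh x) (hd' x).
  exact: le_trans (dh x) (hd' x).
Qed.

Definition net_lfts : lfts R := LFTS net_lowen.

Definition tail (d : X -> R) (z : option (X -> R)) : R :=
  if z is Some d' then (`[< fle d d' >])%:R else 1.

Lemma tail_open d : D d -> opens (l := net_lfts) (tail d).
Proof.
move=> Dd; split=> [[d'|]|t t1] /=; try by rewrite ler01 lexx.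
  by case: asbool; rewrite ?ler01 lexx.
by exists d => // d' _ dd'; rewrite asboolT.
Qed.

End Net.

Section NetGraph.
Variables (X : lfts R) (D : set (X -> R)) (mu : X -> R).
Hypotheses (dirD : directed D) (DX : D `<=` opens (l := X)).
Hypotheses (muX : opens (l := X) mu) (muD : fle mu (pjoin D)).

(** Writing the map d |-> min (d, mu), with limit mu, as a join of open
    rectangles makes its graph visibly open: over d the join runs over the
    members of D below d, and over the limit it runs over all of D.  Cutting
    down by mu makes the limit mu itself, and not the possibly larger join of
    D. *)
Definition net_graph : net_lfts dirD * X -> R :=
  pmeet (mu \o snd) (pjoin [set pmeet (tail d \o fst) (d \o snd) | d in D]).

Lemma net_graph_open : opens (l := prod_lfts (net_lfts dirD) X) net_graph.
Proof.
have PL := opensP (prod_lfts (net_lfts dirD) X).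
apply: (lowen_meet PL); first exact: snd_open.
apply: (lowen_join PL) => _ [d Dd <-].
apply: (lowen_meet PL); last exact: snd_open (DX Dd).
exact: fst_open (tail_open dirD Dd).
Qed.

Lemma net_graph_limit x : net_graph (None, x) = mu x.
Proof.
rewrite /net_graph {1}/pmeet /=; apply/min_idPl; apply: le_trans (muD x) _.
suff -> : pjoin [set pmeet (tail d \o fst) (d \o snd) | d in D] (None, x) =
  pjoin D x by [].
rewrite /pjoin image_comp; congr sup; apply: eq_imagel => d Dd /=.
by rewrite /pmeet /=; apply/min_idPr; case/andP: (opens_fuzzy (DX Dd) x).
Qed.

Lemma net_graph_le d x : D d -> net_graph (Some d, x) <= d x.
Proof.
move=> Dd; rewrite /net_graph {1}/pmeet ge_min; apply/orP; right.
have /andP[d0 _] := opens_fuzzy (DX Dd) x.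
apply: pjoin_le => // _ [e De <-]; rewrite /pmeet /= ge_min.
case: asboolP => [ed|_]; first by rewrite (ed x) orbT.
by rewrite d0.
Qed.

End NetGraph.

(** * Exponentials of the Sierpinski object *)

Section Exponential.
Variables (X : lfts R) (G : functor (LFTS_cat R) (LFTS_cat R)).
Variable adj : adjunction (prod_functor X) G.

(** The exponential of the Sierpinski object by X. *)
Let E : lfts R := G sierpinski.

Let curry (Z : lfts R) (f : cmap (prod_lfts Z X) sierpinski) : cmap Z E :=
  @transpose _ _ _ _ adj Z sierpinski f.

(** Evaluation is the counit of the adjunction, and the equation is the
    triangle identity. *)
Lemma exponential_evaluation : exists2 ev : E * X -> R,
  opens (l := prod_lfts E X) ev &
  forall (Z : lfts R) (f : cmap (prod_lfts Z X) sierpinski) z x,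
    ev (curry f z, x) = level (f (z, x)).
Proof.
have [g gK Kg] := @transpose_bij _ _ _ _ adj E sierpinski.
pose e : cmap (prod_lfts E X) sierpinski := g (idm (c := LFTS_cat R) E).
exists (level \o e); first exact: cmapP e _ level_open.
move=> Z f z x /=.
suff {2}-> : f = comp_cmap e (prod_map X (curry f)) by [].
apply: (ssrfun.bij_inj (transpose_bij adj Z sierpinski)).
have := transpose_natl adj (A := E) (A' := Z) (curry f) e.
by rewrite /e Kg comp_idl => /esym.
Qed.

(** Naturality along points: the value of a transposed map at z depends only
    on the section of the map over z. *)
Lemma curry_point (Z : lfts R) (f : cmap (prod_lfts Z X) sierpinski) z :
  curry (comp_cmap f (prod_map X (point z))) tt = curry f z.
Proof.
have := transpose_natl adj (A := Z) (A' := point_lfts) (point z) f.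
by move=> /(congr1 (fun h : cmap point_lfts E => h tt)).
Qed.

(** The point of the exponential that corresponds to mu. *)
Definition name (mu : X -> R) (muX : opens (l := X) mu) : E :=
  curry (classifier (snd_open (Z := point_lfts) muX)) tt.

(** Identifies transposed maps defined on different spaces through the points
    of E, so that an open of E found near [name mu] can be used on the graph
    of any directed family. *)
Lemma curry_name (Z : lfts R) (w : Z * X -> R)
    (wP : opens (l := prod_lfts Z X) w) z mu (muX : opens (l := X) mu) :
  (forall x, w (z, x) = mu x) -> curry (classifier wP) z = name muX.
Proof.
move=> wmu; rewrite -curry_point /name.
suff -> : comp_cmap (classifier wP) (prod_map X (point z)) =
  classifier (snd_open (Z := point_lfts) muX) by [].
apply: cmap_eq; apply/funext => -[[] x].
by apply: eq_exist => /=; exact: wmu.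
Qed.

(** Scott continuity of a.  The point p of E plays the role of min (d, mu). *)
Lemma name_scott (mu : X -> R) (muX : opens (l := X) mu) (D : set (X -> R))
    (a : E -> R) (t : R) (ev : E * X -> R) :
  (forall (Z : lfts R) (f : cmap (prod_lfts Z X) sierpinski) z x,
    ev (curry f z, x) = level (f (z, x))) ->
  D `<=` opens (l := X) -> directed D -> fle mu (pjoin D) ->
  opens (l := E) a -> t < a (name muX) ->
  exists2 d, D d & exists2 p, t < a p & forall x, ev (p, x) <= d x.
Proof.
move=> evE DX dirD muD aE ta.
pose q := curry (classifier (net_graph_open (dirD := dirD) DX muX)).
have [_ aq] : opens (l := net_lfts dirD) (a \o q) := cmapP q aE.
have [|d Dd dq] := aq t.
  by rewrite /= /q (curry_name _ muX) // => x; exact: net_graph_limit.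
exists d => //; exists (q (Some d)); first exact: dq.
by move=> x; rewrite evE; exact: net_graph_le.
Qed.

End Exponential.

End LowenTopologies.

Theorem theorem6p1 (R : realType) (X : lfts R) :
  exponentiable X -> continuous_lattice (@opens R X).
Proof.
move=> [G [adj]] mu muX.
have [ev evP evE] := exponential_evaluation adj.
have le_mu rho : way_below (opens (l := X)) rho mu -> fle rho mu.
  move=> /(_ [set mu])[|||nu [-> //]]; first by move=> _ ->.
    split; first by exists mu.
    by move=> _ _ -> ->; exists mu; split=> // x.
  by move=> x; rewrite /pjoin image_set1 sup1.
set W := [set rho | _]; apply/funext => x.
have W01 : W `<=` fuzzy_set (X := X) by move=> rho [/opens_fuzzy].
have /andP[mu0 _] := opens_fuzzy muX x.
apply/le_anti/andP; split; last by apply: pjoin_le => // rho [_ /le_mu].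
rewrite leNgt; apply/negP => ltmu.
set t := pjoin W x in ltmu.
have /andP[t0 _] : 0 <= t <= 1 := pjoin_fuzzy W01 x.
(* A level strictly between the join and mu x is attained by some rho way
   below mu, contradicting that t is an upper bound at x. *)
have [s /andP[ts smu]] : exists s, t < s < mu x.
  by exists ((t + mu x) / 2); rewrite !(midf_lt ltmu).
have : s < ev (name adj muX, x) by rewrite evE.
case/(prod_open_rect evP) => a [b [aE bX sa sb abev]].
suff : s <= t by rewrite leNgt ts.
have -> : s = pmeet (fun=> s) b x by rewrite /pmeet min_l // ltW.
apply: pjoin_ub => //; split.
  apply: (lowen_meet (opensP X) _ bX); apply: (lowen_cst (opensP X)).
  rewrite (le_trans t0 (ltW ts)) /=.
  by apply: ltW; apply: lt_le_trans sb _; case/andP: (opens_fuzzy bX x).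
move=> D DX dirD muD.
have [d Dd [p sp pd]] := name_scott evE DX dirD muD aE sa.
exists d; split=> // y; apply: le_trans (pd y).
by apply: le_trans (abev p y); rewrite /pmeet le_min2 // ltW.
Qed.
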